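(* Let $\varphi\colon\mathbb{R}^n\to\mathbb{R}$ be a $\mathcal{C}^2$-smooth function and let $\{x^k\}$, $\{\hat{x}^k\}$ be infinite sequences generated by the globalized Newton algorithm described in the context, with parameters $x^0\in\mathbb{R}^n$, $\sigma\in(0,1/2)$, $\beta\in(0,1)$, $\zeta>0$. Assume that $\inf_k\varphi(x^k)>-\infty$, that $\nabla\varphi$ is Lipschitz continuous on $\mathbb{R}^n$ with modulus $L>0$, and that there exists $c>0$ such that for every $k\in\mathbb{N}$ $$\langle\nabla\varphi(x^k),\hat{x}^k-x^k\rangle\le -c\|x^k-\hat{x}^k\|^2,$$ and $$c>\frac{\alpha L}{2\beta\xi}+L,\qquad 0<\sigma<1-\frac{\alpha L}{2\beta\xi(c-L)},\qquad\text{where }\xi:=\min\{1,\zeta\},\ \alpha:=\max\{1,L\}.$$ Let $\bar{x}$ be an accumulation point of $\{x^k\}$ at which $\varphi$ satisfies the PLK condition. Then the entire sequence $\{x^k\}$ converges to $\bar{x}$, and $\bar{x}$ is a stationary point of $\varphi$. If furthermore $\varphi$ satisfies the exponent PLK condition at $\bar{x}$ with desingularizing function $\phi(t)=Mt^{1-q}$ for some $M>0$ and $q\in[0,1)$, then the following convergence rates hold: (i) If $q\in[0,1/2)$, then $\{x^k\}$ and $\{\varphi(x^k)\}$ terminate in a finite number of steps at $\bar{x}$ and $\varphi(\bar{x})$, respectively. (ii) If $q=1/2$, then $\{x^k\}$ and $\{\varphi(x^k)\}$ converge linearly to $\bar{x}$ and $\varphi(\bar{x})$, respectively. (iii) If $q\in(1/2,1)$,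 then there exists a constant $\varrho>0$ such that $\|x^k-\bar{x}\|\le\varrho\,k^{-\frac{1-q}{2q-1}}$ for all sufficiently large $k\in\mathbb{N}$.
   Context: $\mathbb{R}^n$ carries the Euclidean norm and standard inner product; $\mathbb{N}=\{0,1,2,\dots\}$. A point $\bar x$ is stationary if $\nabla\varphi(\bar x)=0$. For a symmetric matrix $A$, $\lambda_{\min}(A)$ denotes its smallest eigenvalue. Globalized Newton algorithm. Input: $x^0\in\mathbb{R}^n$, $\sigma\in(0,1/2)$, $\beta\in(0,1)$, $\zeta>0$. For $k=0,1,2,\dots$: Step 1: Choose (arbitrarily) $\hat{x}^k\in\mathbb{R}^n$ satisfying $\varphi(\hat{x}^k)\le\varphi(x^k)$. If $\nabla\varphi(\hat{x}^k)=0$, stop. Otherwise go to Step 2. Step 2: Set $d^k=-\nabla^2\varphi(\hat{x}^k)^{-1}\nabla\varphi(\hat{x}^k)$ if $\lambda_{\min}(\nabla^2\varphi(\hat{x}^k))\ge\zeta$, and $d^k=-\nabla\varphi(\hat{x}^k)$ otherwise. Step 3: Let $\tau_k$ be the largest $\tau\in\{\beta^i : i\in\mathbb{N}\}$ such that $\varphi(\hat{x}^k+\tau d^k)\le\varphi(\hat{x}^k)+\sigma\tau\langle\nabla\varphi(\hat{x}^k),d^k\rangle$. Step 4: Set $x^{k+1}:=\hat{x}^k+\tau_k d^k$. PLK (Polyak–Łojasiewicz–Kurdyka) condition: a $\mathcal{C}^1$-smooth function $\varphi\colon\mathbb{R}^n\to\mathbb{R}$ satisfies the PLK condition at $\bar{x}$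 if there exist $\eta\in(0,\infty)$, a neighborhood $U$ of $\bar{x}$, and a concave continuous function $\phi\colon[0,\eta]\to[0,\infty)$ (the desingularizing function) such that $\phi(0)=0$, $\phi\in\mathcal{C}^1(0,\eta)$, $\phi'(s)>0$ for all $s\in(0,\eta)$, and $\phi'(\varphi(x)-\varphi(\bar{x}))\,\|\nabla\varphi(x)\|\ge 1$ for all $x\in U$ with $\varphi(\bar{x})<\varphi(x)<\varphi(\bar{x})+\eta$. The exponent PLK condition is the PLK condition with $\phi(t)=Mt^{1-q}$, where $M>0$ and $q\in[0,1)$. Linear convergence of a sequence $z^k$ to $z$ means a geometric rate: there exist $C>0$ and $\rho\in(0,1)$ with $\|z^k-z\|\le C\rho^k$ for all sufficiently large $k$. *)

(* Defs.v *)
From HB Require Import structures.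
From mathcomp Require Import all_boot all_order all_algebra.
From mathcomp Require Import all_classical all_reals all_analysis.

Set Implicit Arguments.
Unset Strict Implicit.
Unset Printing Implicit Defensive.

Import Order.TTheory GRing.Theory Num.Theory.
Import numFieldNormedType.Exports.

Local Open Scope classical_set_scope.
Local Open Scope ring_scope.

Section Euclidean.
Context {R : realType} {n : nat}.
Implicit Types (x y : 'rV[R]_n).

Definition dot x y : R := \sum_i x 0 i * y 0 i.

(* The library norm `|x| on matrices is the sup norm; it induces the same
   topology, so continuity, differentiability and limits are the library's. *)
Definition enorm x : R := Num.sqrt (dot x x).

Definition elipschitz (L : R) (f : 'rV[R]_n -> 'rV[R]_n) : Prop :=
  forall x y, enorm (f x - f y) <= L * enorm (x - y).

(* For symmetric A with n > 0, the set of eigenvalues is finite and nonempty,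
   so that the infimum is the smallest eigenvalue. *)
Definition lambda_min (A : 'M[R]_n) : R := inf [set a | eigenvalue A a].

End Euclidean.

Section Smoothness.
Context {R : realType} {n : nat}.
Implicit Types (phi : 'rV[R]_n -> R) (x : 'rV[R]_n).

Definition grad phi x : 'rV[R]_n := \row_i 'D_(delta_mx 0 i) phi x.

(* Entry (i, j) is the i-th partial derivative of the j-th component of the
   gradient. As for every library Jacobian, it acts on row vectors from the
   right: the derivative of the gradient along v is v *m hess phi x. *)
Definition hess phi x : 'M[R]_n := 'J (grad phi) x.

Definition C1_smooth phi : Prop :=
  (forall x, differentiable phi x) /\ continuous (grad phi).

Definition C2_smooth phi : Prop :=
  [/\ C1_smooth phi,
      (forall x, differentiable (grad phi) x)
    & continuous (hess phi)].

End Smoothness.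

Section Algorithm.
Context {R : realType} {n : nat}.
Variable phi : 'rV[R]_n -> R.
Implicit Types (x xhat : nat -> 'rV[R]_n) (y d : 'rV[R]_n).

(* grad phi y *m invmx (hess phi y) is the inverse Hessian applied to the
   gradient, in the row-vector convention of hess. *)
Definition newton_direction (zeta : R) y : 'rV[R]_n :=
  if zeta <= lambda_min (hess phi y)
  then - (grad phi y *m invmx (hess phi y))
  else - grad phi y.

Definition armijo_steps (sigma beta : R) y d : set R :=
  [set tau | (exists i : nat, tau = beta ^+ i) /\
     phi (y + tau *: d) <= phi y + sigma * tau * dot (grad phi y) d].

(* The sequences are infinite, so the stopping test never succeeds. *)
Definition newton_run (sigma beta zeta : R) x xhat : Prop :=
  forall k : nat,
    [/\ phi (xhat k) <= phi (x k),
        grad phi (xhat k) <> 0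
      & let d := newton_direction zeta (xhat k) in
        exists tau : R,
          [/\ armijo_steps sigma beta (xhat k) d tau,
              ubound (armijo_steps sigma beta (xhat k) d) tau
            & x k.+1 = xhat k + tau *: d]].

End Algorithm.

Section PLK.
Context {R : realType} {n : nat}.
Variables (phi : 'rV[R]_n -> R) (xbar : 'rV[R]_n).

(* Only the values of psi on [0, eta] matter. *)
Definition PLK_with (psi : R -> R) : Prop :=
  exists (eta : R) (U : set 'rV[R]_n),
    [/\ 0 < eta,
        nbhs xbar U,
        [/\ (forall t, 0 <= t <= eta -> 0 <= psi t),
            convex_function (`[0, eta]%classic : set R) (fun t => - psi t),
            {within `[0, eta], continuous psi}
          & psi 0 = 0],
        [/\ (forall s, 0 < s < eta -> derivable psi s 1),
            {within `]0, eta[, continuous derive1 psi}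
          & (forall s, 0 < s < eta -> 0 < derive1 psi s)]
      & forall x, U x -> phi xbar < phi x < phi xbar + eta ->
          1 <= derive1 psi (phi x - phi xbar) * enorm (grad phi x)].

Definition PLK : Prop := exists psi : R -> R, PLK_with psi.

Definition exponent_PLK (M q : R) : Prop :=
  PLK_with (fun t => M * t `^ (1 - q)).

End PLK.

Definition linear_rate {R : realType} (e : nat -> R) : Prop :=
  exists C rho : R,
    [/\ 0 < C, 0 < rho < 1 & \forall k \near \oo, e k <= C * rho ^+ k].

(* Main.v *)
Require Import Defs.
From HB Require Import structures.
From mathcomp Require Import all_boot all_order all_algebra.
From mathcomp Require Import all_classical all_reals all_analysis.
From mathcomp Require Import ring lra.

Set Implicit Arguments.
Unset Strict Implicit.
Unset Printing Implicit Defensive.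

Import Order.TTheory GRing.Theory Num.Theory.
Import numFieldNormedType.Exports.

Local Open Scope classical_set_scope.
Local Open Scope ring_scope.

(* Put r_k := |xhat_k - x_k| + |x_{k+1} - xhat_k|.  The descent condition on
   xhat_k and the Armijo rule, whose step sizes are bounded below because the
   gradient is Lipschitz, give, with constants a, K > 0,
     phi (x_{k+1}) + a r_k^2 <= phi (x_k)  and  |grad phi (x_k)| <= K r_k.
   For the Newton direction this rests on the symmetry of the Hessian, which
   turns the bound on its smallest eigenvalue into coercivity.  With
   D_k := phi (x_k) - phi xbar, concavity of the desingularizing function psi
   and the PLK inequality at x_k yield r_k <= K/a (psi (D_k) - psi (D_{k+1})),
   so that an iterate close enough to xbar traps all later ones and
   |x_k - xbar| <= K/a psi (D_k).  When psi t = M t^(1-q), the same estimates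
   give D_{k+1} <= D_k - b D_k^(2q), from which the rates follow.  For q < 1/2
   this recursion is impossible when D_k > 0 tends to 0: an infinite run, on
   which no gradient at xhat_k vanishes, does not exist. *)

(** * Euclidean inner product and norm, and their link with the library topology *)

Section EuclideanTheory.
Context {R : realType} {n : nat}.
Implicit Types (x y z : 'rV[R]_n) (a : R).

Lemma dotC x y : dot x y = dot y x.
Proof. by apply: eq_bigr => i _; rewrite mulrC. Qed.

Lemma dotDl x y z : dot (x + y) z = dot x z + dot y z.
Proof. by rewrite /dot -big_split; apply: eq_bigr => i _; rewrite mxE mulrDl. Qed.

Lemma dotZl a x y : dot (a *: x) y = a * dot x y.
Proof. by rewrite /dot mulr_sumr; apply: eq_bigr => i _; rewrite mxE mulrA. Qed.

Lemma dotNl x y : dot (- x) y = - dot x y.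
Proof. by rewrite -scaleN1r dotZl mulN1r. Qed.

Lemma dotBl x y z : dot (x - y) z = dot x z - dot y z.
Proof. by rewrite dotDl dotNl. Qed.

Lemma dotDr x y z : dot x (y + z) = dot x y + dot x z.
Proof. by rewrite dotC dotDl !(dotC x). Qed.

Lemma dotZr a x y : dot x (a *: y) = a * dot x y.
Proof. by rewrite dotC dotZl dotC. Qed.

Lemma dotNr x y : dot x (- y) = - dot x y.
Proof. by rewrite dotC dotNl dotC. Qed.

Lemma dotBr x y z : dot x (y - z) = dot x y - dot x z.
Proof. by rewrite dotDr dotNr. Qed.

Lemma dot0l x : dot 0 x = 0.
Proof. by rewrite -(scale0r 0) dotZl mul0r. Qed.

Lemma dot_ge0 x : 0 <= dot x x.
Proof. by apply: sumr_ge0 => i _; rewrite -expr2 sqr_ge0. Qed.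

Lemma sqr_enorm x : enorm x ^+ 2 = dot x x.
Proof. by rewrite sqr_sqrtr ?dot_ge0. Qed.

Lemma enorm_ge0 x : 0 <= enorm x.
Proof. exact: sqrtr_ge0. Qed.

Lemma enormN x : enorm (- x) = enorm x.
Proof. by rewrite /enorm dotNl dotNr opprK. Qed.

Lemma enormB x y : enorm (x - y) = enorm (y - x).
Proof. by rewrite -enormN opprB. Qed.

Lemma enormZ a x : enorm (a *: x) = `|a| * enorm x.
Proof. by rewrite /enorm dotZl dotZr mulrA -expr2 sqrtrM ?sqr_ge0// sqrtr_sqr. Qed.

Lemma enorm0 : enorm (0 : 'rV[R]_n) = 0.
Proof. by rewrite /enorm dot0l sqrtr0. Qed.

(** This comparison carries Euclidean estimates over to the library's sup-norm balls, limits and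
    boundedness. *)
Lemma normr_le_enorm x : `|x| <= enorm x.
Proof.
rewrite [`|x|]mx_normrE; apply/bigmax_leP; split=> [|[i j] _ /=]; first exact: enorm_ge0.
rewrite -(ler_pXn2r (n := 2)) ?nnegrE ?enorm_ge0// sqr_enorm.
rewrite real_normK ?num_real// /dot (bigD1 j)//= ord1 -expr2 lerDl.
by apply: sumr_ge0 => k _; rewrite -expr2 sqr_ge0.
Qed.

Lemma enorm_eq0 x : enorm x = 0 -> x = 0.
Proof.
move=> x0; apply/eqP; rewrite -normr_eq0 eq_le normr_ge0 andbT.
by rewrite -x0 normr_le_enorm.
Qed.

Lemma enorm_gt0 x : x != 0 -> 0 < enorm x.
Proof.
move=> x0; rewrite lt_neqAle enorm_ge0 andbT eq_sym.
by apply: contra_neq x0; exact: enorm_eq0.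
Qed.

Lemma dot_le_enorm x y : dot x y <= enorm x * enorm y.
Proof.
have [->|y0] := eqVneq y 0; first by rewrite dotC dot0l enorm0 mulr0.
have [->|x0] := eqVneq x 0; first by rewrite dot0l enorm0 mul0r.
have xp := enorm_gt0 x0; have yp := enorm_gt0 y0.
(* With a = |x|, b = |y| and s = <x, y>, this square expands to 2ab(ab - s). *)
have := dot_ge0 (enorm y *: x - enorm x *: y).
rewrite !(dotBl, dotBr, dotZl, dotZr) (dotC y x) -!sqr_enorm.
set a := enorm x in xp *; set b := enorm y in yp *; set s := dot x y => h.
have : 0 <= (2 * (a * b)) * (a * b - s) by nra.
by rewrite pmulr_rge0 ?subr_ge0// !mulr_gt0.
Qed.

Lemma enormD x y : enorm (x + y) <= enorm x + enorm y.
Proof.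
rewrite -(ler_pXn2r (n := 2)) ?nnegrE ?addr_ge0 ?enorm_ge0// sqr_enorm.
rewrite dotDl !dotDr (dotC y x) -!sqr_enorm.
by have := dot_le_enorm x y; nra.
Qed.

Lemma enorm_triangle z x y : enorm (x - y) <= enorm (x - z) + enorm (z - y).
Proof. by rewrite -[x - y](subrKA z) enormD. Qed.

Lemma cvg_dot {T : Type} {F : set_system T} {FF : Filter F}
    (f g : T -> 'rV[R]_n) x y :
  f @ F --> x -> g @ F --> y -> (fun t => dot (f t) (g t)) @ F --> dot x y.
Proof.
move=> fx gy; apply: cvg_big => [|i _]; first exact: add_continuous.
by apply: cvgM; [apply: (@cvg_comp _ _ _ _ (fun v : 'rV[R]_n => v 0 i) _ _ _ fx)
  | apply: (@cvg_comp _ _ _ _ (fun v : 'rV[R]_n => v 0 i) _ _ _ gy)];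
  exact: coord_continuous.
Qed.

Lemma enorm_continuous : continuous (@enorm R n).
Proof.
move=> x; apply: (@continuous_comp _ _ _ (fun x : 'rV[R]_n => dot x x) Num.sqrt).
  by apply: (@cvg_dot _ (nbhs x) _ id id); exact: cvg_id.
exact: sqrt_continuous.
Qed.

Lemma nbhs_enorm_ball x (e : R) : 0 < e -> \forall y \near x, enorm (y - x) < e.
Proof.
move=> e0; have : (fun y => enorm (y - x)) @ x --> (0 : R).
  rewrite -enorm0 -(subrr x).
  apply: (@continuous_comp _ _ _ (fun y => y - x) (@enorm R n)).
    by apply: (@cvgB _ _ _ (nbhs x) _ id (cst x) x x); [exact: cvg_id | exact: cvg_cst].
  exact: enorm_continuous.
move=> /cvgrPdist_lt/(_ e e0); apply: filterS => y.
by rewrite sub0r normrN ger0_norm// enorm_ge0.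
Qed.

End EuclideanTheory.

(** * Mean value arguments, symmetry and boundedness of the Hessian *)

Section Calculus.
Context {R : realType} {n : nat}.
Implicit Types (phi : 'rV[R]_n -> R) (x u v w : 'rV[R]_n).

Lemma cvg_dot_mulmx {T : Type} {F : set_system T} {FF : Filter F}
    (f g : T -> 'rV[R]_n) (A : T -> 'M[R]_n) u v A0 :
  f @ F --> u -> A @ F --> A0 -> g @ F --> v ->
  (fun t => dot (f t *m A t) (g t)) @ F --> dot (u *m A0) v.
Proof.
move=> fu AA gv; apply: cvg_big => [|i _]; first exact: add_continuous.
apply: cvgM; last first.
  by apply: (@cvg_comp _ _ _ g (fun w : 'rV[R]_n => w 0 i) _ _ _ gv);
    exact: coord_continuous.
under eq_cvg do rewrite mxE.
rewrite mxE; apply: cvg_big => [|j _]; first exact: add_continuous.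
apply: cvgM.
  by apply: (@cvg_comp _ _ _ f (fun w : 'rV[R]_n => w 0 j) _ _ _ fu);
    exact: coord_continuous.
by apply: (@cvg_comp _ _ _ A (fun B : 'M[R]_n => B j i) _ _ _ AA);
  exact: coord_continuous.
Qed.

Lemma derive_dot_grad phi x v :
  differentiable phi x -> 'D_v phi x = dot (grad phi x) v.
Proof.
move=> dphi; rewrite deriveE// [in LHS](row_sum_delta v) linear_sum.
by apply: eq_bigr => i _; rewrite linearZ /= mxE deriveE// mulrC.
Qed.

(** The difference quotient of the restriction to a line is, as a function of [h], the directional
    one of [f]. *)
Lemma is_derive_line (W : normedModType R) (f : 'rV[R]_n -> W) x v (t : R) :
  derivable f (x + t *: v) v ->
  is_derive t 1 (fun s : R => f (x + s *: v)) ('D_v f (x + t *: v)).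
Proof.
move=> df; have E : (fun h : R => h^-1 *: (((fun s : R => f (x + s *: v)) \o shift t) h%:A
      - f (x + t *: v))) =
    (fun h : R => h^-1 *: ((f \o shift (x + t *: v)) (h *: v) - f (x + t *: v))).
  apply/funext => h /=; rewrite [h%:A]mulr1 scalerDl addrCA; congr (_ *: (f _ - _)).
by split; rewrite /derivable /derive E.
Qed.

Lemma is_derive_dot (V : normedModType R) (F : V -> 'rV[R]_n) (a b : V) u :
  derivable F a b -> is_derive a b (fun y => dot (F y) u) (dot ('D_b F a) u).
Proof.
move=> dF.
have E : (fun h : R => h^-1 *: (((fun y => dot (F y) u) \o shift a) (h *: b)
      - dot (F a) u)) @ 0^' --> dot ('D_b F a) u.
  have -> : (fun h : R => h^-1 *: (((fun y => dot (F y) u) \o shift a) (h *: b)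
      - dot (F a) u)) =
    (fun h => dot (h^-1 *: ((F \o shift a) (h *: b) - F a)) u).
    by apply/funext => h /=; rewrite dotZl dotBl.
  by apply: cvg_dot; [exact: dF | exact: cvg_cst].
by split; [apply/cvg_ex; exists (dot ('D_b F a) u) | exact: cvg_lim].
Qed.

Lemma MVT_is_derive (f df : R -> R) (a b : R) : a < b ->
  (forall t : R, is_derive t 1 f (df t)) ->
  exists2 c, a < c < b & f b - f a = df c * (b - a).
Proof.
move=> ab fdf; have [|c cab E] := MVT ab (fun t _ => fdf t); last by exists c.
by apply: continuous_subspaceT => t; apply/differentiable_continuous/derivable1_diffP.
Qed.

Lemma line_MVT phi x v : (forall y, differentiable phi y) ->
  exists2 c : R, 0 < c < 1 & phi (x + v) - phi x = dot (grad phi (x + c *: v)) v.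
Proof.
move=> dphi.
have [t|c c01] := @MVT_is_derive (fun s => phi (x + s *: v))
    (fun s => dot (grad phi (x + s *: v)) v) 0 1 ltr01.
  rewrite -derive_dot_grad//; apply: is_derive_line; exact: diff_derivable.
by rewrite scale1r scale0r addr0 subr0 mulr1; exists c.
Qed.

(* The mean value theorem gives L instead of the optimal L / 2; this is enough
   since c > L. *)
Lemma descent_lemma phi (L : R) x v : 0 <= L ->
  (forall y, differentiable phi y) -> elipschitz L (grad phi) ->
  phi (x + v) <= phi x + dot (grad phi x) v + L * enorm v ^+ 2.
Proof.
move=> L0 dphi lip; have [c /andP[c0 c1] E] := line_MVT x v dphi.
rewrite -addrA -lerBlDl E -lerBlDl -dotBl.
apply: le_trans (dot_le_enorm _ _) _; rewrite expr2 mulrA ler_wpM2r ?enorm_ge0//.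
apply: le_trans (lip _ _) _; rewrite addrC addKr enormZ gtr0_norm//.
by rewrite ler_wpM2l// ler_piMl ?enorm_ge0// ltW.
Qed.

(** Two mean value steps: first along [u] for the difference of [phi] on two parallel lines, then
    along [v] for the [u]-component of the gradient. *)
Lemma second_difference phi x u v (t : R) : C2_smooth phi -> 0 < t ->
  exists s r : R, [/\ 0 < s < t, 0 < r < t &
    phi (x + t *: u + t *: v) - phi (x + t *: u) - phi (x + t *: v) + phi x
    = t ^+ 2 * dot (v *m hess phi (x + s *: u + r *: v)) u].
Proof.
move=> [[dphi _] dgrad _] t0.
have [s0|s st Es] := @MVT_is_derive
    ((fun s => phi (x + t *: v + s *: u)) - (fun s => phi (x + s *: u)))
    (fun s => dot (grad phi (x + t *: v + s *: u)) u - dot (grad phi (x + s *: u)) u)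
    0 t t0.
  by apply: is_deriveB; rewrite -derive_dot_grad//; apply: is_derive_line;
    exact: diff_derivable.
have [r0|r rt Er] := @MVT_is_derive (fun r => dot (grad phi (x + s *: u + r *: v)) u)
    (fun r => dot (v *m hess phi (x + s *: u + r *: v)) u) 0 t t0.
  have dl := is_derive_line (diff_derivable (v := v) (dgrad (x + s *: u + r0 *: v))).
  have := is_derive_dot u (@ex_derive _ _ _ _ _ _ _ dl).
  by rewrite (@derive_val _ _ _ _ _ _ _ dl) deriveEjacobian.
exists s, r; split=> //; move: Es Er.
rewrite -![(_ - _ : _ -> _) _]/(_ - _) /= !scale0r !addr0 !subr0.
rewrite [x + t *: v + t *: u]addrAC [x + t *: v + s *: u]addrAC.
move=> Es Er; rewrite Er in Es; rewrite [RHS]mulrC expr2 mulrA -Es.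
by ring.
Qed.

(** The second difference is symmetric in [u] and [v]. Evaluating it in both orders equates the two
    forms at two points near [x], and continuity of the Hessian transfers this to [x] up to [e]. *)
Lemma hess_sym phi x u v : C2_smooth phi ->
  dot (u *m hess phi x) v = dot (v *m hess phi x) u.
Proof.
move=> C2; have [_ _ chess] := C2.
have cont (a b : 'rV[R]_n) :
    (fun y => dot (a *m hess phi y) b) @ x --> dot (a *m hess phi x) b.
  by apply: (cvg_dot_mulmx (F := nbhs x) (cvg_cst a) (chess x) (cvg_cst b)).
apply/eqP; rewrite -subr_eq0 -normr_le0; apply/ler_addgt0Pl => e e0.
have e2 : 0 < e / 2 by rewrite divr_gt0.
have /nbhs_ballP[d /= d0 Hd] :
    \forall y \near x, `|dot (u *m hess phi x) v - dot (u *m hess phi y) v| < e / 2 /\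
      `|dot (v *m hess phi x) u - dot (v *m hess phi y) u| < e / 2.
  apply: filterI; [move/cvgrPdist_lt: (cont u v) | move/cvgrPdist_lt: (cont v u)];
    exact.
have uv0 : 0 < `|u| + `|v| + 1 by rewrite addrC ltr_pwDl// addr_ge0.
(* Small enough to keep every intermediate point in the ball of radius [d]; the 1 keeps the
   denominator positive when [u] and [v] vanish. *)
pose t := d / (`|u| + `|v| + 1).
have t0 : 0 < t by rewrite divr_gt0.
have inball (a b : 'rV[R]_n) (s r : R) : `|a| + `|b| = `|u| + `|v| ->
    0 < s < t -> 0 < r < t -> ball x d (x + s *: a + r *: b).
  move=> ab /andP[s0 st] /andP[r0 rt]; rewrite -ball_normE/= -addrA opprD addNKr normrN.
  apply: le_lt_trans (ler_normD _ _) _; rewrite !normrZ !gtr0_norm//.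
  apply: (@le_lt_trans _ _ (t * (`|a| + `|b|))).
    by rewrite mulrDr lerD// ler_wpM2r// ltW.
  rewrite ab /t mulrAC ltr_pdivrMr// ltr_pM2l// ltrDl ltr01//.
have [s [r [st rt E1]]] := second_difference x u v C2 t0.
have [s' [r' [st' rt' E2]]] := second_difference x v u C2 t0.
rewrite [x + t *: v + _]addrAC [X in X + phi x]addrAC in E2.
have t2 : t ^+ 2 != 0 by rewrite expf_neq0// gt_eqF.
have near_eq (a b p q : R) : p = q -> `|a - p| < e / 2 -> `|b - q| < e / 2 ->
    `|a - b| <= e + 0.
  by move=> ->; rewrite !ltr_norml ler_norml => /andP[? ?] /andP[? ?]; lra.
apply: near_eq (mulfI t2 (etrans (esym E2) E1)) _ _.
  by have [] := Hd _ (inball v u s' r' (addrC _ _) st' rt').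
by have [] := Hd _ (inball u v s r erefl st rt).
Qed.

(** The Hessian applied to [v] is a limit of difference quotients of the gradient, each bounded by
    L|v|. *)
Lemma enorm_hess_le phi (L : R) x v : (forall y, differentiable (grad phi) y) ->
  elipschitz L (grad phi) -> enorm (v *m hess phi x) <= L * enorm v.
Proof.
move=> dgrad lip; rewrite -deriveEjacobian//.
have lip0 y : enorm (grad phi y - grad phi 0) <= L * enorm y.
  by apply: le_trans (lip _ _) _; rewrite subr0.
pose q h := h^-1 *: ((grad phi \o shift x) (h *: v) - grad phi x).
have cv : (@enorm R n \o q) @ 0^' --> enorm ('D_v (grad phi) x).
  exact: cvg_comp (diff_derivable (v := v) (dgrad x)) (@enorm_continuous _ _ _).
rewrite -(cvg_lim _ cv)//; apply: limr_le; first by apply/cvg_ex; eexists; exact: cv.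
(* At [h = 0] the quotient is 0 by the convention on inverses, and [lip0 v] shows that the bound is
   nonnegative. *)
apply: nearW => h; have [->|h0] := eqVneq h 0.
  by rewrite /q /= invr0 scale0r enorm0 (le_trans (enorm_ge0 _) (lip0 v)).
rewrite /q /= enormZ normfV ler_pdivrMl ?normr_gt0//.
by apply: le_trans (lip _ _) _; rewrite addrK enormZ mulrCA.
Qed.

End Calculus.

(** * Smallest eigenvalue of a symmetric matrix and coercivity *)

Section Rayleigh.
Context {R : realType} {n : nat}.
Implicit Types (A : 'M[R]_n) (u v w : 'rV[R]_n).

Lemma sphere_compact : compact [set v : 'rV[R]_n | enorm v = 1].
Proof.
apply: bounded_closed_compact.
  exists 1; split; first exact: real1.
  move=> M M1 v /= v1; apply: le_trans (ltW M1); rewrite -v1.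
  exact: normr_le_enorm.
rewrite (_ : [set v | _] = @enorm R n @^-1` [set 1]); last by [].
apply: preimage_closed => [v _|]; first exact: enorm_continuous.
exact: closed_eq.
Qed.

(* The eigenvalue m is the minimum of the quadratic form on the unit sphere. *)
Lemma sym_form_min_eigenvalue A v0 : v0 != 0 ->
  (forall u v, dot (u *m A) v = dot (v *m A) u) ->
  exists2 m, eigenvalue A m & forall v, m * dot v v <= dot (v *m A) v.
Proof.
move=> v00 symA.
have [] := @EVT_min_rV R n (fun v => dot (v *m A) v) [set v | enorm v = 1].
- exists ((enorm v0)^-1 *: v0) => /=.
  rewrite enormZ normfV ger0_norm ?enorm_ge0// mulVf// gt_eqF//.
  exact: enorm_gt0.
- exact: sphere_compact.
- apply: continuous_subspaceT => v.
  exact: (cvg_dot_mulmx (F := nbhs v) (f := id) (g := id) cvg_id (cvg_cst A) cvg_id).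
move=> w /set_mem /= w1 wmin; set m := dot (w *m A) w in wmin.
have mle v : m * dot v v <= dot (v *m A) v.
  have [->|vn0] := eqVneq v 0; first by rewrite mul0mx !dot0l mulr0.
  have vp := enorm_gt0 vn0.
  have /wmin : (enorm v)^-1 *: v \in [set v : 'rV[R]_n | enorm v = 1].
    by apply/mem_set => /=; rewrite enormZ normfV gtr0_norm// mulVf// gt_eqF.
  rewrite -scalemxAl dotZl dotZr mulrA -expr2 exprVn -sqr_enorm.
  by rewrite ler_pdivlMl ?exprn_gt0// mulrC.
exists m => //; apply/eigenvalueP; exists w; last first.
  by apply: contra_eq_neq w1 => ->; rewrite enorm0 eq_sym oner_eq0.
apply/eqP; rewrite -subr_eq0; apply/eqP.
(* The residual [p] of the eigenvalue equation, kept opaque. It vanishes because perturbing the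
   minimizer [w] along [p] cannot lower the form minus [m] times the squared norm. *)
have [p pE] : exists p, p = w *m A - m *: w by eexists.
rewrite -pE; have ww : dot w w = 1 by rewrite -sqr_enorm w1 expr1n.
pose b := dot (p *m A) p - m * dot p p.
have b0 : 0 <= b by rewrite subr_ge0.
have pp : dot (w *m A) p - m * dot w p = dot p p by rewrite -dotZl -dotBl -pE.
have key (t : R) : 0 <= 2 * t * dot p p + t ^+ 2 * b.
  have := mle (w + t *: p); rewrite -subr_ge0 mulmxDl -scalemxAl.
  rewrite !(dotDl, dotDr, dotZl, dotZr) (dotC p w) (symA p w) ww /b -pp -/m.
  by congr (0 <= _); ring.
(* A negative [t] makes the linear term of [key] dominate; [b + 1] avoids dividing by [b], which may
   be 0. *)
have := key (- (dot p p / (b + 1))).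
have b1 : b + 1 != 0 by rewrite gt_eqF// ltr_wpDl.
have -> : 2 * - (dot p p / (b + 1)) * dot p p + (- (dot p p / (b + 1))) ^+ 2 * b =
  - ((dot p p / (b + 1)) ^+ 2 * (b + 2)) by field.
rewrite oppr_ge0 pmulr_lle0 ?ltr_wpDl//.
rewrite exprn_even_le0//= mulf_eq0 invr_eq0 (negbTE b1) orbF -sqr_enorm sqrf_eq0.
by move/eqP/enorm_eq0.
Qed.

Lemma lambda_min_le A (z a : R) :
  0 < z <= lambda_min A -> eigenvalue A a -> z <= a.
Proof.
move=> /andP[z0 zl] ea; apply: (le_trans zl).
(* Without an infimum, [inf] takes the default value 0, which contradicts
   [0 < z <= lambda_min A]. *)
have [hi|nhi] := pselect (has_inf [set a | eigenvalue A a]).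
  by apply: ge_inf => //; case: hi.
by move: (lt_le_trans z0 zl); rewrite /lambda_min inf_out// ltxx.
Qed.

Lemma sym_form_ge_lambda_min A (z : R) v :
  (forall u v, dot (u *m A) v = dot (v *m A) u) ->
  0 < z <= lambda_min A -> z * dot v v <= dot (v *m A) v.
Proof.
move=> symA zl; have [->|v0] := eqVneq v 0; first by rewrite mul0mx !dot0l mulr0.
have [m em mle] := sym_form_min_eigenvalue v0 symA.
by apply: le_trans (mle v); rewrite ler_wpM2r ?dot_ge0// (lambda_min_le zl).
Qed.

Lemma coercive_unitmx A (z : R) : 0 < z ->
  (forall v, z * dot v v <= dot (v *m A) v) -> A \in unitmx.
Proof.
move=> z0 zA; rewrite -row_free_unit -kermx_eq0; apply/rowV0P => v /sub_kermxP vA.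
have := zA v; rewrite vA dot0l pmulr_rle0// -sqr_enorm exprn_even_le0//=.
by move/eqP/enorm_eq0.
Qed.

End Rayleigh.

(** * Search directions, step sizes and decrease along one iteration *)

Section NewtonStep.
Context {R : realType} {n : nat}.
Variables (phi : 'rV[R]_n -> R) (L zeta : R).
Hypotheses (C2 : C2_smooth phi) (L_gt0 : 0 < L) (zeta_gt0 : 0 < zeta).
Hypothesis lip : elipschitz L (grad phi).
Let xi := Num.min 1 zeta.
Let alpha := Num.max 1 L.

(** For a Newton direction the gradient is [- d *m A], so coercivity gives the constant [zeta] and
    the Hessian bound gives [L]. For a gradient direction both constants are 1; [xi] and [alpha]
    cover the two cases. *)
Lemma newton_direction_bounds y (d := newton_direction phi zeta y) :
  dot (grad phi y) d <= - xi * enorm d ^+ 2 /\ enorm (grad phi y) <= alpha * enorm d.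
Proof.
have [_ dgrad _] := C2; rewrite {}/d /newton_direction.
have a1 : 1 <= alpha by rewrite le_max lexx.
have aL : L <= alpha by rewrite le_max lexx orbT.
have xi1 : xi <= 1 by rewrite ge_min lexx.
have xiz : xi <= zeta by rewrite ge_min lexx orbT.
case: ifPn => [zl|_]; last first.
  rewrite enormN dotNr -sqr_enorm mulNr lerN2 ler_piMl ?sqr_ge0//; split=> //.
  by rewrite ler_peMl ?enorm_ge0.
set A := hess phi y in zl *; set g := grad phi y.
have zA v : zeta * dot v v <= dot (v *m A) v.
  by apply: sym_form_ge_lambda_min; [move=> ? ?; exact: hess_sym | rewrite zeta_gt0].
have uA := coercive_unitmx zeta_gt0 zA.
have : g = - (- (g *m invmx A) *m A) by rewrite mulNmx mulmxKV// opprK.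
move: (- (g *m invmx A)) => d dA; rewrite dA dotNl enormN mulNr lerN2 sqr_enorm; split.
  by apply: le_trans (zA d); rewrite ler_wpM2r ?dot_ge0.
by apply: le_trans (enorm_hess_le _ _ dgrad lip) _; rewrite ler_wpM2r ?enorm_ge0.
Qed.

(** Either the full step is taken, or the preceding trial step [beta ^+ i] failed. If [tau] were
    below the bound, the descent lemma would make that larger trial step acceptable, against
    maximality. *)
Lemma armijo_step_ge (sigma beta c tau : R) y d : 0 < beta < 1 -> 0 < sigma < 1 ->
  0 < c -> dot (grad phi y) d <= - c * enorm d ^+ 2 ->
  armijo_steps phi sigma beta y d tau ->
  ubound (armijo_steps phi sigma beta y d) tau ->
  Num.min 1 (beta * ((1 - sigma) * c / L)) <= tau <= 1.
Proof.
move=> /andP[b0 b1] /andP[s0 s1] c0 gd [[[|i] ->] ta] ub.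
  by rewrite expr0 lexx ge_min lexx.
have t0 : 0 < beta ^+ i by rewrite exprn_gt0.
rewrite exprn_ile1 ?(ltW b0) ?(ltW b1)// andbT ge_min exprS ler_pM2l//.
apply/orP; right.
rewrite leNgt; apply/negP => tl.
suff /ub : armijo_steps phi sigma beta y d (beta ^+ i).
  by rewrite exprS leNgt gtr_pMl// b1.
split; first by exists i.
have [[dphi _] _ _] := C2.
apply: le_trans (descent_lemma y (_ *: d) (ltW L_gt0) dphi lip) _.
rewrite dotZr enormZ gtr0_norm// exprMn.
have tL : beta ^+ i * L <= (1 - sigma) * c by rewrite -ler_pdivlMr// ltW.
set t := beta ^+ i in t0 tL *; set g := dot _ d in gd *; set N := enorm d ^+ 2 in gd *.
rewrite -addrA lerD2l.
have N0 : 0 <= N by rewrite sqr_ge0.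
suff : t * ((1 - sigma) * g + t * L * N) <= 0 by nra.
rewrite pmulr_rle0//.
have : t * L * N <= (1 - sigma) * c * N by rewrite ler_wpM2r.
have : (1 - sigma) * g <= (1 - sigma) * (- c * N) by rewrite ler_wpM2l// subr_ge0 ltW.
by lra.
Qed.

(** Extracts from the algorithm the sufficient decrease and relative error bounds on which the
    convergence analysis rests. *)
Lemma newton_run_decrease (x xhat : nat -> 'rV[R]_n) (sigma beta c : R) :
  0 < beta < 1 -> 0 < sigma < 1 -> L < c ->
  newton_run phi sigma beta zeta x xhat ->
  (forall k, dot (grad phi (x k)) (xhat k - x k) <= - c * enorm (x k - xhat k) ^+ 2) ->
  exists a K : R, exists r : nat -> R, [/\ 0 < a, 0 < K & forall k,
    [/\ 0 < r k, enorm (x k.+1 - x k) <= r k, enorm (grad phi (x k)) <= K * r k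
      & phi (x k.+1) + a * r k ^+ 2 <= phi (x k)]].
Proof.
move=> beta01 sigma01 Lc run desc.
have [[dphi _] _ _] := C2.
have /andP[s0 s1] := sigma01; have /andP[b0 b1] := beta01.
have xi0 : 0 < xi by rewrite lt_min ltr01.
have al0 : 0 < alpha by rewrite lt_max ltr01.
pose tm := Num.min 1 (beta * ((1 - sigma) * xi / L)).
have tm0 : 0 < tm by rewrite lt_min ltr01 !mulr_gt0 ?invr_gt0 ?subr_gt0.
pose a := Num.min (c - L) (sigma * xi).
have a0 : 0 < a by rewrite lt_min subr_gt0 Lc mulr_gt0.
(* The half comes from (A + B)^2 <= 2(A^2 + B^2). In the gradient bound, [L] pays for moving from
   [x k] to [xhat k], and [alpha / tm] for expressing |d| by the length of the actual step. *)
exists (a / 2), (L + alpha / tm),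
  (fun k => enorm (xhat k - x k) + enorm (x k.+1 - xhat k)).
split=> [||k]; [by rewrite divr_gt0| by rewrite addr_gt0 ?divr_gt0|].
have [_ gn0 [tau [ta ub xk1]]] := run k.
set d := newton_direction phi zeta (xhat k) in ta ub xk1.
have [gd gal] := newton_direction_bounds (xhat k); rewrite -/d in gd gal.
have := armijo_step_ge beta01 sigma01 xi0 gd ta ub; rewrite -/tm => /andP[tmt t1].
have tau0 : 0 < tau := lt_le_trans tm0 tmt.
(* The gradient at [xhat k] is nonzero since the run never stops; this makes [r k] positive. *)
have d0 : 0 < enorm d.
  by rewrite -(pmulr_rgt0 _ al0); apply: lt_le_trans gal; apply/enorm_gt0/eqP.
have BE : enorm (x k.+1 - xhat k) = tau * enorm d.
  by rewrite xk1 addrC addKr enormZ gtr0_norm.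
have A0 := enorm_ge0 (xhat k - x k); split.
- by rewrite ltr_wpDl// BE mulr_gt0.
- by rewrite [leRHS]addrC; exact: enorm_triangle.
- rewrite -[grad phi (x k)](subrK (grad phi (xhat k))).
  apply: le_trans (enormD _ _) _.
  have gL := lip (x k) (xhat k); rewrite (enormB (x k)) in gL.
  have dB : alpha * enorm d <= alpha / tm * enorm (x k.+1 - xhat k).
    by rewrite BE -mulrA ler_pM2l// ler_pdivlMl// ler_pM2r.
  have LB : 0 <= L * enorm (x k.+1 - xhat k) by rewrite mulr_ge0 ?enorm_ge0// ltW.
  have aA : 0 <= alpha / tm * enorm (xhat k - x k) by rewrite mulr_ge0// ltW// divr_gt0.
  by rewrite mulrDl !mulrDr; lra.
- have h1 : phi (xhat k) <= phi (x k) - (c - L) * enorm (xhat k - x k) ^+ 2.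
    have := descent_lemma (x k) (xhat k - x k) (ltW L_gt0) dphi lip.
    by rewrite addrC subrK => h; have := desc k; rewrite (enormB (x k)); lra.
  have h2 : phi (x k.+1) <= phi (xhat k) - sigma * xi * enorm (x k.+1 - xhat k) ^+ 2.
    rewrite {1}xk1; apply: le_trans ta.2 _; rewrite BE exprMn lerD2l.
    have st : 0 < sigma * tau by rewrite mulr_gt0.
    have : sigma * tau * dot (grad phi (xhat k)) d <= sigma * tau * (- xi * enorm d ^+ 2).
      by rewrite ler_pM2l.
    (* Since [tau <= 1], the Armijo decrease, of order tau |d|^2, dominates the squared step length
       tau^2 |d|^2. *)
    have : 0 <= sigma * tau * xi * enorm d ^+ 2 * (1 - tau).
      by rewrite !mulr_ge0 ?sqr_ge0 ?subr_ge0// ltW.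
    lra.
  have a1 : a <= c - L by rewrite ge_min lexx.
  have a2 : a <= sigma * xi by rewrite ge_min lexx orbT.
  set A := enorm (xhat k - x k) in A0 h1 *; set B := enorm (x k.+1 - _) in h2 *.
  have : a * A ^+ 2 <= (c - L) * A ^+ 2 by rewrite ler_wpM2r ?sqr_ge0.
  have : a * B ^+ 2 <= sigma * xi * B ^+ 2 by rewrite ler_wpM2r ?sqr_ge0.
  have : 0 <= a * (A - B) ^+ 2 by rewrite mulr_ge0 ?sqr_ge0// ltW.
  nra.
Qed.

End NewtonStep.

(** * Tangent inequality for concave functions of one variable *)

Lemma concave_tangent (R : realType) (psi : R -> R) (eta s t : R) :
  convex_function (`[0, eta]%classic : set R) (fun t => - psi t) ->
  derivable psi t 1 -> 0 <= s -> s <= t -> t <= eta ->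
  derive1 psi t * (t - s) <= psi t - psi s.
Proof.
move=> cvx dpsi s0 st te.
have dft : differentiable psi t by apply/derivable1_diffP.
have cv : derivable psi t (s - t) by exact: diff_derivable.
have -> : derive1 psi t * (t - s) = - 'D_(s - t) psi t.
  have DE (v : R) : 'D_v psi t = v * 'D_1 psi t.
    by rewrite !deriveE// -[in LHS](mulr1 v); exact: linearZ.
  by rewrite derive1E DE; ring.
(* A right limit suffices: for [h] in (0, 1) the quotient towards [s] uses only points between [s]
   and [t], where concavity is available even if [t = eta]. *)
rewrite lerNl opprB /derive cvg_at_rightE//; apply: limr_ge.
  by apply/cvg_ex; eexists; exact: cvg_dnbhs_at_right cv.
near=> h; have h0 : 0 < h by near: h; exact: nbhs_right_gt.
have h1 : h < 1 by near: h; exact: nbhs_right_lt.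
rewrite /= [_ *: _](_ : _ = h^-1 * (psi (h * (s - t) + t) - psi t))// ler_pdivlMl//.
have : - psi (h * s + (1 - h) * t) <= h * - psi s + (1 - h) * - psi t.
  apply: (cvx (Itv01 (ltW h0) (ltW h1)) s t); rewrite inE /= in_itv /=.
    by rewrite s0 (le_trans st).
  by rewrite te (le_trans s0).
have -> : h * s + (1 - h) * t = h * (s - t) + t by ring.
by lra.
Unshelve. all: by end_near. Qed.

(** * Convergence of descent sequences under the PLK condition *)

Section DescentSequence.
Context {R : realType} {n : nat}.
Variables (phi : 'rV[R]_n -> R) (x : nat -> 'rV[R]_n) (xbar : 'rV[R]_n).
Variables (a K : R) (r : nat -> R).
Hypotheses (a_gt0 : 0 < a) (K_gt0 : 0 < K).
Hypothesis phi_cont : continuous phi.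
Hypothesis decrease : forall k,
  [/\ 0 < r k, enorm (x k.+1 - x k) <= r k, enorm (grad phi (x k)) <= K * r k
    & phi (x k.+1) + a * r k ^+ 2 <= phi (x k)].
Hypothesis xbar_acc : cluster (x @ \oo) xbar.

Let Delta k := phi (x k) - phi xbar.

Lemma cluster_seq_frequently (U : set 'rV[R]_n) N :
  nbhs xbar U -> exists2 m, (N <= m)%N & U (x m).
Proof.
move=> xU; have [|_ [[m Nm <-] Um]] := xbar_acc (A := x @` [set m | (N <= m)%N]) _ xU.
  by exists N => // m Nm; exists m.
by exists m.
Qed.

Lemma descent_lt k : phi (x k.+1) < phi (x k).
Proof.
have [r0 _ _] := decrease k; apply: lt_le_trans.
by rewrite ltrDl mulr_gt0// exprn_gt0.
Qed.

Lemma descent_le k m : (k <= m)%N -> phi (x m) <= phi (x k).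
Proof.
elim: m => [|m IH]; first by rewrite leqn0 => /eqP ->.
rewrite leq_eqVlt => /predU1P[->//|]; rewrite ltnS => /IH.
exact/le_trans/ltW/descent_lt.
Qed.

(** A value below [phi xbar] would, by continuity, be exceeded by a later iterate near the
    accumulation point, against monotonicity. Strictness makes the PLK inequality applicable at
    every iterate near [xbar]. *)
Lemma descent_gt_limit k : phi xbar < phi (x k).
Proof.
apply: le_lt_trans (descent_lt k); rewrite leNgt; apply/negP => lt.
have [|m km] := @cluster_seq_frequently [set y | phi (x k.+1) < phi y] k.+1.
  exact: (cvgr_gt (phi xbar) (@phi_cont xbar)).
by rewrite /= ltNge descent_le.
Qed.

Lemma descent_cvg (e : R) : 0 < e -> exists N, forall k, (N <= k)%N -> Delta k < e.
Proof.
move=> e0; have [|m _ /= me] := @cluster_seq_frequently [set y | phi y < phi xbar + e] 0.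
  by apply: (cvgr_lt (phi xbar) (@phi_cont xbar)); rewrite ltrDl.
by exists m => k mk; rewrite ltrBlDl (le_lt_trans (descent_le mk)).
Qed.

Lemma plk_step (psi : R -> R) (eta : R) (U : set 'rV[R]_n) k :
  convex_function (`[0, eta]%classic : set R) (fun t => - psi t) ->
  (forall s, 0 < s < eta -> derivable psi s 1) ->
  (forall s, 0 < s < eta -> 0 < derive1 psi s) ->
  (forall y, U y -> phi xbar < phi y < phi xbar + eta ->
     1 <= derive1 psi (phi y - phi xbar) * enorm (grad phi y)) ->
  U (x k) -> Delta k < eta ->
  1 <= derive1 psi (Delta k) * (K * r k) /\
  r k <= K / a * (psi (Delta k) - psi (Delta k.+1)).
Proof.
move=> cvx dpsi psi'0 plk Uk De.
have [r0 _ gk dec] := decrease k.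
have D0 : 0 < Delta k by rewrite subr_gt0 descent_gt_limit.
have D1 : 0 < Delta k.+1 by rewrite subr_gt0 descent_gt_limit.
have DD : Delta k.+1 <= Delta k by rewrite lerD2r descent_le.
have De' : 0 < Delta k < eta by rewrite D0.
have p0 := psi'0 _ De'.
have p1 : 1 <= derive1 psi (Delta k) * (K * r k).
  apply: le_trans (plk _ Uk _) _.
    by rewrite descent_gt_limit -ltrBlDl.
  by rewrite ler_pM2l.
split=> //.
have tg := concave_tangent cvx (dpsi _ De') (ltW D1) DD (ltW De).
have dd : a * r k ^+ 2 <= Delta k - Delta k.+1 by rewrite /Delta; lra.
rewrite mulrAC ler_pdivlMr// mulrC.
(* The tangent inequality bounds this middle term from above; [p1] absorbs the derivative and one
   factor [r k], leaving [a * r k]. *)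
apply: (@le_trans _ _ (K * (derive1 psi (Delta k) * (a * r k ^+ 2)))); last first.
  by rewrite ler_pM2l//; apply: le_trans tg; rewrite ler_pM2l.
have -> : K * (derive1 psi (Delta k) * (a * r k ^+ 2)) =
  derive1 psi (Delta k) * (K * r k) * (a * r k) by ring.
by rewrite ler_peMl// mulr_ge0// ltW.
Qed.

Lemma plk_convergence (psi : R -> R) : PLK_with phi xbar psi ->
  (forall e, 0 < e -> exists N, forall k, (N <= k)%N -> enorm (x k - xbar) < e) /\
  exists N, forall k, (N <= k)%N ->
    1 <= derive1 psi (Delta k) * (K * r k) /\
    enorm (x k - xbar) <= K / a * psi (Delta k).
Proof.
move=> [eta [U [eta0 xU [psi0 cvx cpsi psi00] [dpsi _ psi'0] plk]]].
have D0 k : 0 < Delta k by rewrite subr_gt0 descent_gt_limit.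
have Ka : 0 < K / a by rewrite divr_gt0.
have step k := @plk_step psi eta U k cvx dpsi psi'0 plk.
have telescope N j : (forall i, (i < j)%N -> U (x (N + i)%N) /\ Delta (N + i)%N < eta) ->
    enorm (x (N + j)%N - x N) <= K / a * (psi (Delta N) - psi (Delta (N + j)%N)).
  elim: j => [|j IH] h; first by rewrite addn0 !subrr enorm0 mulr0.
  have {}IH := IH (fun i ij => h i (ltnW ij)).
  have [Uj Dj] := h j (ltnSn j); have [_ rj] := step _ Uj Dj.
  have [_ xr _ _] := decrease (N + j)%N.
  rewrite addnS; apply: le_trans (enorm_triangle (x (N + j)%N) _ _) _.
  by move: (psi (Delta (N + j)%N)) IH rj => p IH rj; lra.
(* Start at an iterate within [rho / 2] of [xbar] whose remaining path length, at most
   [K / a * psi (Delta m)], is also below [rho / 2]. By strong induction no later iterate leaves the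
   ball of radius [rho], on which PLK holds. *)
have trap e : 0 < e -> exists N, forall k, (N <= k)%N ->
    [/\ enorm (x k - xbar) < e, U (x k) & Delta k < eta].
  move=> e0; have /nbhs_ballP[d /= d0 dU] := xU.
  pose rho := Num.min e d.
  have rho0 : 0 < rho by rewrite lt_min e0.
  have [N1 N1eta] := descent_cvg eta0.
  have [N2 N2psi] : exists N, forall k, (N <= k)%N -> K / a * psi (Delta k) < rho / 2.
    have z0 : (0 : R) \in (`[0, eta]%classic : set R).
      by rewrite inE /= in_itv /= lexx ltW.
    have : psi @ within (`[0, eta]%classic : set R) (nbhs (0 : R)) --> psi 0.
      by have /subspace_continuousP/(_ 0 (set_mem z0)) := cpsi.
    have p0 : 0 < rho / 2 / (K / a) by rewrite !divr_gt0.
    move=> /cvgrPdist_lt/(_ _ p0); rewrite near_withinE => /nbhs_ballP[s /= s0 sP].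
    have [N NP] : exists N, forall k, (N <= k)%N -> Delta k < Num.min s eta.
      by apply: descent_cvg; rewrite lt_min s0.
    exists N => k /NP; rewrite lt_min => /andP[ks ke].
    rewrite mulrC -ltr_pdivlMr//.
    have := sP (Delta k); rewrite psi00 sub0r normrN; move=> H.
    apply: le_lt_trans (ler_norm _) (H _ _).
      by rewrite -ball_normE /= sub0r normrN gtr0_norm.
    by rewrite /= in_itv /= !ltW.
  have [m Nm /= xm] := cluster_seq_frequently (maxn N1 N2)
     (nbhs_enorm_ball xbar (divr_gt0 rho0 (ltr0Sn R 1))).
  have [N1m N2m] : (N1 <= m)%N /\ (N2 <= m)%N by apply/andP; rewrite -geq_max.
  have in_ball k : enorm (x k - xbar) < rho -> enorm (x k - xbar) < e /\ U (x k).
    rewrite lt_min => /andP[ke kd]; split=> //; apply: dU; rewrite -ball_normE /=.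
    by rewrite distrC; apply: le_lt_trans (normr_le_enorm _) kd.
  have De j : Delta (m + j)%N < eta by apply: N1eta; rewrite (leq_trans N1m)// leq_addr.
  have near_m j : enorm (x (m + j)%N - xbar) < rho.
    elim/ltn_ind: j => j IH.
    have tl := telescope m j (fun i ij => conj (in_ball _ (IH i ij)).2 (De i)).
    apply: le_lt_trans (enorm_triangle (x m) _ _) _.
    have := N2psi m N2m.
    have : 0 <= K / a * psi (Delta (m + j)%N).
      by rewrite mulr_ge0 ?(ltW Ka)// psi0// ltW//= ltW.
    by move: tl xm; rewrite mulrBr; lra.
  exists m => k mk; rewrite -(subnKC mk).
  by have [] := in_ball _ (near_m (k - m)%N).
split=> [e /trap[N NP]|]; first by exists N => k /NP[].
have [N NP] := trap 1 ltr01; exists N => k Nk.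
have [_ Uk Dk] := NP k Nk; split; first by have [] := step k Uk Dk.
(* The telescoped bound from [k] to an iterate [e]-close to [xbar] gives the distance estimate up to
   [e]. *)
apply/ler_addgt0Pr => e e0; have [N' N'P] := trap e e0.
have tl := telescope k N' (fun i _ =>
  let: And3 _ u d := NP (k + i)%N (leq_trans Nk (leq_addr i k)) in conj u d).
have [xe _ De] := N'P (k + N')%N (leq_addl k N').
have := enorm_triangle (x (k + N')%N) (x k) xbar; rewrite (enormB (x k) (x _)).
have [_ _ DN] := NP (k + N')%N (leq_trans Nk (leq_addr N' k)).
have : 0 <= K / a * psi (Delta (k + N')%N).
  by rewrite mulr_ge0 ?(ltW Ka)// psi0// ltW//= ltW.
by move: tl; rewrite mulrBr; lra.
Qed.

End DescentSequence.

(** * Rates for positive sequences with power-type decrease *)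

Section Rates.
Context {R : realType}.
Variables (D : nat -> R) (b p : R) (N : nat).
Hypotheses (D_gt0 : forall k, 0 < D k) (b_gt0 : 0 < b).
Hypothesis D_step : forall k, (N <= k)%N -> D k.+1 + b * D k `^ p <= D k.

(** Positivity of [D k.+1] forces b <= D_k^(1 - p), which fails once [D k] is small. *)
Lemma powR_descent_lt1 : p < 1 ->
  ~ (forall e, 0 < e -> exists N, forall k, (N <= k)%N -> D k < e).
Proof.
move=> p1 cv; have p0 : 0 < 1 - p by rewrite subr_gt0.
have [m mP] := cv (b `^ (1 - p)^-1) (powR_gt0 _ b_gt0).
have k1 := mP _ (leq_maxl m N); have k2 := D_step (leq_maxr m N).
move: (maxn m N) k1 k2 => k k1 k2.
have := gt0_ltr_powR p0 (ltW (D_gt0 k)) (powR_ge0 _ _) k1.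
rewrite -powRrM mulVf ?gt_eqF// powRr1 ?(ltW b_gt0)//; apply/negP; rewrite -leNgt.
have Dp : 0 < D k `^ p by rewrite powR_gt0.
rewrite -(ler_pM2r Dp) -powRD; last by rewrite (gt_eqF (D_gt0 k)) implybT.
rewrite subrK powRr1 ?(ltW (D_gt0 k))//.
by apply: le_trans k2; rewrite lerDr ltW.
Qed.

Lemma powR_descent_eq1 : p = 1 ->
  exists C rho : R, [/\ 0 < C, 0 < rho < 1 & forall k, (N <= k)%N -> D k <= C * rho ^+ k].
Proof.
move=> p1; have step k : (N <= k)%N -> D k.+1 <= (1 - b) * D k.
  by move=> /D_step; rewrite p1 powRr1 ?(ltW (D_gt0 k))//; lra.
(* Positivity of [D N.+1] excludes [b >= 1]. *)
have rho0 : 0 < 1 - b.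
  by have := lt_le_trans (D_gt0 N.+1) (step N (leqnn N)); rewrite pmulr_lgt0.
have rhoN := exprn_gt0 N rho0.
exists (D N / (1 - b) ^+ N), (1 - b); split; first by rewrite divr_gt0.
  by rewrite rho0/= gtrBl.
move=> k /subnKC <-; elim: (k - N)%N => [|j IH].
  by rewrite addn0 divfK// gt_eqF.
rewrite addnS; apply: le_trans (step _ (leq_addr _ _)) _.
by rewrite exprS mulrCA ler_pM2l.
Qed.

(* Convexity of t `^ (1 - p), in the form y `^ (1 - p) >= z `^ (1 - p) +
   (p - 1) z `^ (- p) (z - y), makes D `^ (1 - p) grow at least linearly. *)
Lemma powR_descent_step (y z : R) : 1 < p -> 0 < y -> 0 < z -> y + b * z `^ p <= z ->
  z `^ (1 - p) + (p - 1) * b <= y `^ (1 - p).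
Proof.
move=> p1 y0 z0 yz.
have z1p : 0 < z `^ (1 - p) by rewrite powR_gt0.
have zz : z `^ (1 - p) * z `^ p = z.
  by rewrite -powRD ?subrK ?powRr1 ?(ltW z0)// (gt_eqF z0) implybT.
have -> : y `^ (1 - p) = z `^ (1 - p) * (y / z) `^ (1 - p).
  by rewrite -powRM ?divr_ge0 ?ltW// mulrCA divff ?mulr1// gt_eqF.
have t0 : 0 < y / z by rewrite divr_gt0.
(* Bernoulli's inequality for a negative exponent, from exp u >= 1 + u and ln w <= w - 1. *)
have tl : 1 + (p - 1) * (1 - y / z) <= (y / z) `^ (1 - p).
  rewrite /powR gt_eqF//; apply: le_trans (expR_ge1Dx _); rewrite lerD2l.
  have := @le_ln1Dx R (y / z - 1); rewrite [1 + _]addrC subrK => lnle.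
  have {}lnle : ln (y / z) <= y / z - 1 by apply: lnle; lra.
  by nra.
apply: (@le_trans _ _ (z `^ (1 - p) * (1 + (p - 1) * (1 - y / z)))); last first.
  by rewrite ler_pM2l.
rewrite mulrDr mulr1 lerD2l mulrCA ler_pM2l ?subr_gt0//.
rewrite -(ler_pM2r z0) -mulrA mulrBl mul1r divfK ?gt_eqF//.
by rewrite -{1}zz mulrCA ler_pM2l//; lra.
Qed.

(** Summing the increments of D^(1 - p) gives linear growth; raising to the negative power -1/(p -
    1) reverses the inequality. *)
Lemma powR_descent_gt1 : 1 < p ->
  exists2 C : R, 0 < C &
    exists m, forall k, (m <= k)%N -> D k <= C * k%:R `^ (- (p - 1)^-1).
Proof.
move=> p1; have s0 : 0 < p - 1 by rewrite subr_gt0.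
have sb : 0 < (p - 1) * b by rewrite mulr_gt0.
have growth j : j%:R * ((p - 1) * b) <= D (N + j)%N `^ (1 - p).
  elim: j => [|j IH]; first by rewrite mul0r powR_ge0.
  have := powR_descent_step p1 (D_gt0 _) (D_gt0 _) (D_step (leq_addr j N)).
  by rewrite addnS; apply: le_trans; rewrite -natr1 [leLHS]mulrDl mul1r lerD2r.
pose C := (p - 1) * b / 2.
have C0 : 0 < C by rewrite divr_gt0.
exists (C `^ (- (p - 1)^-1)); first by rewrite powR_gt0.
(* Beyond 2N one has k - N >= k/2, whence the half in [C]; the successor ensures k > 0. *)
exists (N.*2.+1) => k Nk.
have k0 : 0 < k%:R :> R by rewrite ltr0n (leq_trans _ Nk).
have Nk' : (N <= k)%N by rewrite (leq_trans _ (ltnW Nk))// -addnn leq_addr.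
rewrite -powRM ?(ltW C0) ?(ltW k0)//.
have Ck : C * k%:R <= D k `^ (1 - p).
  have := growth (k - N)%N; rewrite subnKC//; apply: le_trans.
  rewrite natrB// /C mulrAC -mulrA mulrC ler_pM2r//.
  have : (N.*2)%:R <= k%:R :> R by rewrite ler_nat ltnW.
  by rewrite -addnn natrD; lra.
have DE : D k = (D k `^ (1 - p)) `^ (- (p - 1)^-1).
  rewrite -powRrM (_ : (1 - p) * _ = 1) ?powRr1 ?(ltW (D_gt0 k))//.
  by field; rewrite gt_eqF.
rewrite [leLHS]DE !powRN lef_pV2 ?posrE ?powR_gt0 ?mulr_gt0//.
by apply: ge0_ler_powR; rewrite ?invr_ge0 ?(ltW s0)// nnegrE ?powR_ge0// ltW// mulr_gt0.
Qed.

End Rates.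

(** * Desingularizing functions of power type *)

Section ExponentPLK.
Context {R : realType}.

Lemma derive1_exponent (M q s : R) : 0 < s ->
  derive1 (fun t => M * t `^ (1 - q)) s = M * ((1 - q) * s `^ (- q)).
Proof.
move=> s0; rewrite derive1E; have d := is_derive1_powR (1 - q) s0.
rewrite (_ : (fun t => _) = M *: (@powR R ^~ (1 - q)))//.
by rewrite deriveZ// derive_val (_ : 1 - q - 1 = - q)//; ring.
Qed.

(** For this [psi] the hypothesis reads s^q <= M(1 - q)K r; squaring it turns the decrease
    [a * r ^+ 2] into a power of the gap [s]. *)
Lemma exponent_decrease (a K M q s r : R) : 0 < a -> 0 < K -> 0 < M -> q < 1 -> 0 < s ->
  0 < r -> 1 <= derive1 (fun t => M * t `^ (1 - q)) s * (K * r) ->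
  a / (M * (1 - q) * K) ^+ 2 * s `^ (2 * q) <= a * r ^+ 2.
Proof.
move=> a0 K0 M0 q1 s0 r0; rewrite derive1_exponent// powRN.
set c := M * (1 - q) * K => h.
have c0 : 0 < c by rewrite !mulr_gt0// subr_gt0.
have sq : 0 < s `^ q by rewrite powR_gt0.
have {}h : s `^ q <= c * r.
  rewrite -[leLHS]mul1r -ler_pdivlMr//; apply: le_trans h _.
  by rewrite /c le_eqVlt; apply/orP; left; apply/eqP; ring.
rewrite -mulrA ler_pM2l// ler_pdivrMl ?exprn_gt0// -exprMn mulrC powRrM.
by rewrite -[2]/(2%:R) powR_mulrn ?powR_ge0// lerXn2r// nnegrE ltW// mulr_gt0.
Qed.

End ExponentPLK.

(** * Convergence of the iterates, stationarity of the limit and the three rates *)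

Theorem theorem3p3 (R : realType) (n : nat) (phi : 'rV[R]_n -> R)
    (x xhat : nat -> 'rV[R]_n) (sigma beta zeta L c : R) (xbar : 'rV[R]_n)
    (xi := Num.min 1 zeta) (alpha := Num.max 1 L)
    (phi_C2 : C2_smooth phi)
    (sigma_bounds : 0 < sigma < 1 / 2)
    (beta_bounds : 0 < beta < 1)
    (zeta_gt0 : 0 < zeta)
    (run : newton_run phi sigma beta zeta x xhat)
    (phi_bounded : (-oo < ereal_inf (range (fun k => (phi (x k))%:E)))%E)
    (L_gt0 : 0 < L)
    (grad_lip : elipschitz L (grad phi))
    (c_gt0 : 0 < c)
    (descent : forall k : nat,
       dot (grad phi (x k)) (xhat k - x k) <= - c * enorm (x k - xhat k) ^+ 2)
    (c_large : alpha * L / (2 * beta * xi) + L < c)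
    (sigma_small :
       0 < sigma < 1 - alpha * L / (2 * beta * xi * (c - L)))
    (xbar_acc : cluster (x @ \oo) xbar)
    (plk : PLK phi xbar) :
  [/\ x @ \oo --> xbar,
      grad phi xbar = 0
    & forall M q : R, 0 < M -> 0 <= q < 1 -> exponent_PLK phi xbar M q ->
      [/\ q < 1 / 2 ->
            (\forall k \near \oo, x k = xbar) /\
            (\forall k \near \oo, phi (x k) = phi xbar),
          q = 1 / 2 ->
            linear_rate (fun k => enorm (x k - xbar)) /\
            linear_rate (fun k => `|phi (x k) - phi xbar|)
        & 1 / 2 < q ->
            exists2 rho : R, 0 < rho &
              \forall k \near \oo,
                enorm (x k - xbar) <=
                rho * k%:R `^ (- ((1 - q) / (2 * q - 1)))]].
Proof.
have [[dphi _] _ _] := phi_C2.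
have /andP[b0 b1] := beta_bounds; have /andP[s0 s12] := sigma_bounds.
have phi_cont : continuous phi by move=> y; exact: differentiable_continuous.
have xi0 : 0 < xi by rewrite lt_min ltr01.
have al0 : 0 < alpha by rewrite lt_max ltr01.
have Lc : L < c by apply: le_lt_trans c_large; rewrite lerDr divr_ge0// ltW// !mulr_gt0.
have sigma01 : 0 < sigma < 1 by rewrite s0; lra.
have [a [K [r [a0 K0 dec]]]] :=
  newton_run_decrease phi_C2 L_gt0 zeta_gt0 grad_lip beta_bounds sigma01 Lc run descent.
have Delta0 k : 0 < phi (x k) - phi xbar.
  by rewrite subr_gt0; exact: descent_gt_limit a0 phi_cont dec xbar_acc k.
have Delta_cvg := descent_cvg a0 phi_cont dec xbar_acc.
have converge := plk_convergence a0 K0 phi_cont dec xbar_acc.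
have [psi /converge[x_cvg _]] := plk.
split.
- apply/cvgrPdist_lt => e /x_cvg[N NP]; exists N => // k /NP; apply: le_lt_trans.
  by rewrite distrC; exact: normr_le_enorm.
(* If the limit gradient had norm G > 0, then for large [k] both the Lipschitz error L|x_k - xbar|
   and the bound K r_k on the gradient at [x k] would be below G/2. The latter holds because a r_k^2
   is less than the vanishing gap. *)
- apply: contrapT => /eqP/enorm_gt0; set G := enorm _ => G0.
  have [N1 N1P] : exists N, forall k, (N <= k)%N -> enorm (x k - xbar) < G / 2 / L.
    by apply: x_cvg; rewrite !divr_gt0.
  have [N2 N2P] : exists N, forall k, (N <= k)%N ->
      phi (x k) - phi xbar < a * (G / 2 / K) ^+ 2.
    by apply: Delta_cvg; rewrite mulr_gt0// exprn_gt0// !divr_gt0.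
  have := N1P _ (leq_maxl N1 N2); have := N2P _ (leq_maxr N1 N2).
  move: (maxn N1 N2) => k phik xk; have [r0 _ gk dk] := dec k.
  have rk : r k < G / 2 / K.
    rewrite -(ltr_pXn2r (n := 2)) ?nnegrE ?(ltW r0)// ?(ltW _) ?divr_gt0//.
    by rewrite -(ltr_pM2l a0); apply: le_lt_trans phik; have := Delta0 k.+1; lra.
  have := grad_lip xbar (x k).
  have := enorm_triangle (grad phi (x k)) (grad phi xbar) 0; rewrite !subr0 -/G.
  rewrite (enormB xbar); move: xk rk; rewrite !ltr_pdivlMr// => xk rk.
  by lra.
move=> M q M0 /andP[q0 q1] /converge[_ [N NP]].
pose D k := phi (x k) - phi xbar; pose b := a / (M * (1 - q) * K) ^+ 2.
have b_gt0 : 0 < b by rewrite divr_gt0// exprn_gt0// !mulr_gt0// subr_gt0.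
have D_step k : (N <= k)%N -> D k.+1 + b * D k `^ (2 * q) <= D k.
  move=> /NP[h _]; have [r0 _ _ dk] := dec k.
  have := exponent_decrease a0 K0 M0 q1 (Delta0 k) r0 h.
  by rewrite -/b /D; move: dk; lra.
have x_le k : (N <= k)%N -> enorm (x k - xbar) <= K / a * M * D k `^ (1 - q).
  by move=> /NP[_]; rewrite mulrA.
have KM : 0 < K / a * M by rewrite !mulr_gt0 ?invr_gt0.
split=> q12.
- have p1 : 2 * q < 1 by lra.
  by case: (powR_descent_lt1 Delta0 b_gt0 D_step p1).
- have p1 : 2 * q = 1 by lra.
  have [C [rho [C0 /andP[rho0 rho1] CP]]] := powR_descent_eq1 Delta0 b_gt0 D_step p1.
  split; last first.
    exists C, rho; rewrite C0 rho0 rho1; split=> //; exists N => // k /CP.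
    by rewrite ger0_norm// ltW.
  (* For q = 1/2 the distance is controlled by the square root of the gap, so constant and ratio
     become square roots. *)
  exists (K / a * M * Num.sqrt C), (Num.sqrt rho); split.
  + by rewrite mulr_gt0// sqrtr_gt0.
  + by rewrite sqrtr_gt0 rho0 -[ltRHS]sqrtr1 ltr_sqrt.
  exists N => // k Nk; apply: le_trans (x_le _ Nk) _.
  rewrite -[leRHS]mulrA ler_pM2l// (_ : 1 - q = 2^-1); last by lra.
  rewrite powR12_sqrt ?(ltW (Delta0 k))//.
  rewrite -(ler_pXn2r (n := 2)) ?nnegrE ?mulr_ge0 ?exprn_ge0 ?sqrtr_ge0//.
  by rewrite exprMn exprAC !sqr_sqrtr ?(ltW C0) ?(ltW rho0) ?(ltW (Delta0 k))// CP.
- have p1 : 1 < 2 * q by lra.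
  have [C C0 [m mP]] := powR_descent_gt1 Delta0 b_gt0 D_step p1.
  exists (K / a * M * C `^ (1 - q)); first by rewrite mulr_gt0// powR_gt0.
  exists (maxn m N) => // k; rewrite /= geq_max => /andP[/mP Dk Nk].
  apply: le_trans (x_le _ Nk) _; rewrite -[leRHS]mulrA ler_pM2l//.
  (* The gap decays with exponent -1/(2q - 1); the distance bound raises it to the power 1 - q. *)
  have -> : - ((1 - q) / (2 * q - 1)) = - (2 * q - 1)^-1 * (1 - q) by rewrite mulNr mulrC.
  rewrite powRrM -powRM ?powR_ge0 ?(ltW C0)//.
  apply: ge0_ler_powR => //; first by rewrite subr_ge0 ltW.
    by rewrite nnegrE ltW// Delta0.
  by rewrite nnegrE mulr_ge0 ?powR_ge0// ltW.
Qed.
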